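(* Let $R$ and $S$ be two rings with local units. Then the following conditions are equivalent. (a) There exists a duality between the category of finitely generated unitary left $R$-modules and the category of finitely generated unitary right $S$-modules. (b) $R$ is a left Morita ring and there exists a duality $\mathrm{inj}R\rightarrow\mathrm{proj}S^{\mathrm{op}}$.
   Context: Rings are associative, not necessarily with identity. A ring $R$ has local units if every finite subset of $R$ is contained in a subring $eRe$ with $e^2=e\in R$. A left $R$-module $M$ is unitary if $RM=M$ (similarly on the right). $R\mathrm{Mod}$ (resp. $\mathrm{Mod}S$) is the category of unitary left $R$-modules (resp. unitary right $S$-modules), and $R\mathrm{mod}$ (resp. $\mathrm{mod}S$) its full subcategory of finitely generated modules. A duality between additive categories is an additive contravariant functor that is an equivalence. $R$ is left Morita if there exist a ring $R'$ with local units and a duality $R\mathrm{mod}\to\mathrm{mod}R'$. $\mathrm{inj}R$ is the full subcategory of $R\mathrm{Mod}$ of finitely generated unitary left $R$-modules which are injective in $R\mathrm{Mod}$. $\mathrm{proj}S^{\mathrm{op}}$ is the full subcategory of $\mathrm{Mod}S$ of finitely generated unitary right $S$-modules which are projective in $\mathrm{Mod}S$. *)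

(* Defs.v *)
From HB Require Import structures.
From mathcomp Require Import all_boot all_algebra.
From mathcomp Require Import boolp functions.

Set Implicit Arguments.
Unset Strict Implicit.
Unset Printing Implicit Defensive.

Import GRing.Theory.
Local Open Scope ring_scope.

(* MathComp's rings all have an identity, so associative rings without one are
   built here on top of [zmodType].  All rings and modules below have carriers
   in the universe of [zmodType], which plays the role of the class of sets. *)
HB.mixin Record Zmodule_isRng R of GRing.Zmodule R := {
  rngmul : R -> R -> R;
  rngmulA : associative rngmul;
  rngmulDl : left_distributive rngmul +%R;
  rngmulDr : right_distributive rngmul +%R
}.

#[short(type="rngType")]
HB.structure Definition Rng := {R of Zmodule_isRng R & GRing.Zmodule R}.

(* The opposite ring, on MathComp's converse carrier [R^c]. *)
Section OppositeRing.
Variable R : rngType.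

Definition convmul (a b : R^c) : R^c := rngmul (b : R) (a : R).

Fact convmulA : associative convmul.
Proof. by move=> a b c; rewrite /convmul rngmulA. Qed.

Fact convmulDl : left_distributive convmul +%R.
Proof. by move=> a b c; rewrite /convmul rngmulDr. Qed.

Fact convmulDr : right_distributive convmul +%R.
Proof. by move=> a b c; rewrite /convmul rngmulDl. Qed.

HB.instance Definition _ :=
  Zmodule_isRng.Build R^c convmulA convmulDl convmulDr.

End OppositeRing.

Definition local_units (R : rngType) : Prop :=
  forall s : seq R, exists e : R, rngmul e e = e /\
    forall x, x \in s -> exists r, x = rngmul (rngmul e r) e.

(* Left modules.  A right [S]-module is a left [S^c]-module, with
   [m s = rngact s m]. *)
HB.mixin Record Zmodule_isRngModule (R : rngType) M of GRing.Zmodule M := {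
  rngact : R -> M -> M;
  rngactA : forall a b m, rngact (rngmul a b) m = rngact a (rngact b m);
  rngactDl : forall a b m, rngact (a + b) m = rngact a m + rngact b m;
  rngactDr : forall a m n, rngact a (m + n) = rngact a m + rngact a n
}.

#[short(type="rngModType")]
HB.structure Definition RngModule (R : rngType) :=
  {M of Zmodule_isRngModule R M & GRing.Zmodule M}.

(* [R M = M], where [R M] is the set of finite sums of products [r m]. *)
Definition unitary (R : rngType) (M : rngModType R) : Prop :=
  forall m : M, exists s : seq (R * M), m = \sum_(p <- s) rngact p.1 p.2.

Definition submodule (R : rngType) (M : rngModType R) (N : M -> Prop) : Prop :=
  [/\ N 0,
      forall m n, N m -> N n -> N (m - n)
    & forall r m, N m -> N (rngact r m)].

Definition finitely_generated (R : rngType) (M : rngModType R) : Prop :=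
  exists s : seq M, forall N : M -> Prop,
    submodule N -> (forall x, x \in s -> N x) -> forall m, N m.

Section ModuleHomomorphisms.
Variables (R : rngType) (M N : rngModType R).

Definition is_modhom (f : M -> N) : Prop :=
  (forall m n, f (m + n) = f m + f n) /\
  (forall r m, f (rngact r m) = rngact r (f m)).

Definition modhom_pred : {pred M -> N} := fun f => `[< is_modhom f >].

Fact rngact0 r : rngact r (0 : N) = 0.
Proof. by apply: (addrI (rngact r 0)); rewrite -rngactDr !addr0. Qed.

Fact rngactN r (n : N) : rngact r (- n) = - rngact r n.
Proof. by apply: (addrI (rngact r n)); rewrite -rngactDr !subrr rngact0. Qed.

Fact modhom_zmod_closed : zmod_closed modhom_pred.
Proof.
split; first by apply/asboolP; split=> [m n|r m]; rewrite ?addr0 ?rngact0.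
move=> f g /asboolP[fD fZ] /asboolP[gD gZ]; apply/asboolP; split=> [m n|r m].
  by change (f (m + n) - g (m + n) = f m - g m + (f n - g n));
     rewrite fD gD opprD addrACA.
by change (f (rngact r m) - g (rngact r m) = rngact r (f m - g m));
   rewrite fZ gZ rngactDr rngactN.
Qed.
HB.instance Definition _ :=
  GRing.isZmodClosed.Build (M -> N) modhom_pred modhom_zmod_closed.

Record modhom := ModHom {modhom_fun :> M -> N; _ : modhom_fun \in modhom_pred}.

HB.instance Definition _ := [isSub for modhom_fun].
HB.instance Definition _ := [Choice of modhom by <:].
HB.instance Definition _ := [SubChoice_isSubZmodule of modhom by <:].

Fact modhomP (f : modhom) : is_modhom f.
Proof. exact/asboolP/(valP f). Qed.

Fact modhom_eq (f g : modhom) : f =1 g -> f = g.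
Proof. by move=> fg; apply/val_inj/funext. Qed.

End ModuleHomomorphisms.

Arguments modhom_pred {R} M N.

Section ModuleCategoryOperations.
Variable R : rngType.

Fact modhom_id_subproof (M : rngModType R) : (@id M) \in modhom_pred M M.
Proof. exact/asboolP. Qed.

Definition modhom_id (M : rngModType R) : modhom M M :=
  ModHom (modhom_id_subproof M).

Fact modhom_comp_subproof (L M N : rngModType R)
  (g : modhom M N) (f : modhom L M) : g \o f \in modhom_pred L N.
Proof.
have [[gD gZ] [fD fZ]] := (modhomP g, modhomP f).
by apply/asboolP; split=> * /=; rewrite ?fD ?gD ?fZ ?gZ.
Qed.

Definition modhom_comp (L M N : rngModType R)
  (g : modhom M N) (f : modhom L M) : modhom L N :=
  ModHom (modhom_comp_subproof g f).

End ModuleCategoryOperations.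

(* Additive functors and dualities only involve the preadditive structure of an
   additive category, so zero objects and biproducts are not part of the data. *)
Record preadditive := Preadditive {
  obj :> Type;
  mor : obj -> obj -> zmodType;
  idm : forall x, mor x x;
  mcomp : forall x y z, mor y z -> mor x y -> mor x z;
  comp1m : forall x y (f : mor x y), mcomp (idm y) f = f;
  compm1 : forall x y (f : mor x y), mcomp f (idm x) = f;
  compA : forall w x y z (h : mor y z) (g : mor x y) (f : mor w x),
    mcomp h (mcomp g f) = mcomp (mcomp h g) f;
  compDl : forall x y z (h g : mor y z) (f : mor x y),
    mcomp (h + g) f = mcomp h f + mcomp g f;
  compDr : forall x y z (h : mor y z) (f g : mor x y),
    mcomp h (f + g) = mcomp h f + mcomp h g
}.
Arguments mor {p} x y.
Arguments idm {p} x.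
Arguments mcomp {p x y z} g f.

Section CategoryConstructions.
Variable C : preadditive.

Definition opcat : preadditive :=
  @Preadditive C (fun x y => @mor C y x) (fun x => idm x)
    (fun x y z g f => mcomp f g)
    (fun x y f => compm1 f) (fun x y f => comp1m f)
    (fun w x y z h g f => esym (compA f g h))
    (fun x y z h g f => compDr f h g) (fun x y z h f g => compDl f g h).

Definition fullsub (P : C -> Prop) : preadditive :=
  @Preadditive {x : C | P x} (fun x y => mor (sval x) (sval y))
    (fun x => idm (sval x)) (fun x y z g f => mcomp g f)
    (fun x y f => comp1m f) (fun x y f => compm1 f)
    (fun w x y z h g f => compA h g f)
    (fun x y z h g f => compDl h g f) (fun x y z h f g => compDr h f g).

Definition isomorphism (x y : C) (f : mor x y) : Prop :=
  exists g : mor y x, mcomp g f = idm x /\ mcomp f g = idm y.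

Definition monomorphism (x y : C) (f : mor x y) : Prop :=
  forall w (g h : mor w x), mcomp f g = mcomp f h -> g = h.

Definition epimorphism (x y : C) (f : mor x y) : Prop :=
  forall z (g h : mor y z), mcomp g f = mcomp h f -> g = h.

Definition injective_object (q : C) : Prop :=
  forall (x y : C) (i : mor x y), monomorphism i ->
    forall f : mor x q, exists g : mor y q, mcomp g i = f.

Definition projective_object (p : C) : Prop :=
  forall (x y : C) (q : mor x y), epimorphism q ->
    forall f : mor p y, exists g : mor p x, mcomp q g = f.

End CategoryConstructions.

Record functor (C D : preadditive) := Functor {
  fobj :> C -> D;
  fmap : forall x y : C, mor x y -> mor (fobj x) (fobj y);
  fmap1 : forall x : C, fmap (idm x) = idm (fobj x);
  fmapM : forall (x y z : C) (g : mor y z) (f : mor x y),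
    fmap (mcomp g f) = mcomp (fmap g) (fmap f)
}.
Arguments fmap {C D} F {x y} f : rename.

Definition functor_id (C : preadditive) : functor C C :=
  @Functor C C id (fun _ _ f => f) (fun _ => erefl) (fun _ _ _ _ _ => erefl).

Section FunctorComposition.
Variables (C D E : preadditive) (G : functor D E) (F : functor C D).

Let gf (x y : C) (f : mor x y) : mor (G (F x)) (G (F y)) := fmap G (fmap F f).

Fact functor_comp1 (x : C) : gf (idm x) = idm (G (F x)).
Proof. by rewrite /gf !fmap1. Qed.

Fact functor_compM (x y z : C) (g : mor y z) (f : mor x y) :
  gf (mcomp g f) = mcomp (gf g) (gf f).
Proof. by rewrite /gf !fmapM. Qed.

Definition functor_comp : functor C E := Functor functor_comp1 functor_compM.

End FunctorComposition.

Definition naturally_isomorphic (C D : preadditive) (F G : functor C D) :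
    Prop :=
  exists eta : forall x : C, mor (F x) (G x),
    (forall x, isomorphism (eta x)) /\
    (forall (x y : C) (f : mor x y),
       mcomp (eta y) (fmap F f) = mcomp (fmap G f) (eta x)).

Definition additive_functor (C D : preadditive) (F : functor C D) : Prop :=
  forall (x y : C) (f g : mor x y), fmap F (f + g) = fmap F f + fmap F g.

Definition equivalence (C D : preadditive) (F : functor C D) : Prop :=
  exists G : functor D C,
    naturally_isomorphic (functor_comp G F) (functor_id C) /\
    naturally_isomorphic (functor_comp F G) (functor_id D).

(* A contravariant functor [C -> D] is a functor [opcat C -> D]. *)
Definition duality (C D : preadditive) : Prop :=
  exists F : functor (opcat C) D, additive_functor F /\ equivalence F.

Section ModuleCategories.
Variable R : rngType.

Definition all_modules : preadditive.
Proof.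
apply: (@Preadditive _ (@modhom R) (@modhom_id R) (@modhom_comp R)).
- by move=> M N f; exact: modhom_eq.
- by move=> M N f; exact: modhom_eq.
- by move=> K L M N h g f; exact: modhom_eq.
- by move=> L M N h g f; exact: modhom_eq.
- move=> L M N h f g; apply: modhom_eq => m /=.
  by have [hD _] := modhomP h; exact: hD.
Defined.

(* [R Mod]; [Mod S] is [Mod S^c]. *)
Definition Mod : preadditive := fullsub (C := all_modules) (@unitary R).

Definition fg_in_Mod (M : Mod) : Prop :=
  @finitely_generated R (sval M : rngModType R).

Definition fgMod : preadditive := fullsub fg_in_Mod.

(* Injectivity and projectivity are taken in [Mod], not in [fgMod]. *)
Definition fgInj : preadditive :=
  fullsub (fun M : Mod => fg_in_Mod M /\ injective_object M).

Definition fgProj : preadditive :=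
  fullsub (fun M : Mod => fg_in_Mod M /\ projective_object M).

End ModuleCategories.

Definition left_Morita (R : rngType) : Prop :=
  exists R' : rngType, local_units R' /\ duality (fgMod R) (fgMod R'^c).

(* Main.v *)
(* Each object of [fgMod R] is a quotient of a finitely generated projective [P]
   by a submodule of [P].  Submodules of [P] are directed sieves on [P] in
   [fgProj R], so [fgProj R] determines [fgMod R] up to additive equivalence.

   A duality between [fgMod R] and [fgMod S^c] turns cokernels of the latter
   into kernels of the former, so submodules of finitely generated unitary
   left [R]-modules are finitely generated.  By Baer's criterion the injectives
   of [fgMod R] are then the finitely generated injectives of [Mod R], while the
   projectives of [fgMod S^c] are the finitely generated projectives of
   [Mod S^c] because they are retracts of modules [(eS)^n].  Hence the duality
   restricts to one between [fgInj R] and [fgProj S^c].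

   Conversely, a duality between [fgMod R] and [fgMod R'^c] restricts in the same
   way; together with the one between [fgInj R] and [fgProj S^c] it gives an
   equivalence of [fgProj R'^c] with [fgProj S^c], hence of [fgMod R'^c] with
   [fgMod S^c]. *)

From HB Require Import structures.
From mathcomp Require Import all_boot all_algebra.
From mathcomp Require Import boolp classical_sets.
Require Import Defs.

Set Implicit Arguments.
Unset Strict Implicit.
Unset Printing Implicit Defensive.

Import GRing.Theory.
Local Open Scope ring_scope.

(** * Equivalences of preadditive categories *)

Section Preadditive.
Variable C : preadditive.

Lemma mcompm0 (x y z : C) (h : mor y z) : mcomp h (0 : mor x y) = 0.
Proof. by apply: (addrI (mcomp h 0)); rewrite -compDr !addr0. Qed.

Lemma isomorphism_mono (x y : C) (f : mor x y) :
  isomorphism f -> monomorphism f.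
Proof.
move=> [g [gf _]] w a b /(congr1 (mcomp g)).
by rewrite !compA gf !comp1m.
Qed.

Lemma isomorphism_epi (x y : C) (f : mor x y) :
  isomorphism f -> epimorphism f.
Proof.
move=> [g [_ fg]] w a b /(congr1 (fun c => mcomp c g)).
by rewrite -!compA fg !compm1.
Qed.

End Preadditive.

Definition faithful (C D : preadditive) (F : functor C D) : Prop :=
  forall (x y : C) (f g : mor x y), fmap F f = fmap F g -> f = g.

Definition full (C D : preadditive) (F : functor C D) : Prop :=
  forall (x y : C) (g : mor (F x) (F y)), exists f : mor x y, fmap F f = g.

Definition ess_surjective (C D : preadditive) (F : functor C D) : Prop :=
  forall y : D, exists (x : C) (i : mor (F x) y), isomorphism i.

Definition weak_equivalence (C D : preadditive) (F : functor C D) : Prop :=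
  [/\ faithful F, full F & ess_surjective F].

Lemma fmap_iso (C D : preadditive) (F : functor C D) (x y : C) (f : mor x y) :
  isomorphism f -> isomorphism (fmap F f).
Proof.
by move=> [g [gf fg]]; exists (fmap F g); rewrite -!fmapM gf fg !fmap1.
Qed.

Lemma fmap0 (C D : preadditive) (F : functor C D) (x y : C) :
  additive_functor F -> fmap F (0 : mor x y) = 0.
Proof. by move=> addF; apply: (addrI (fmap F 0)); rewrite -addF !addr0. Qed.

Lemma fmapB (C D : preadditive) (F : functor C D) (x y : C) (f g : mor x y) :
  additive_functor F -> fmap F (f - g) = fmap F f - fmap F g.
Proof. by move=> addF; apply: (addIr (fmap F g)); rewrite -addF !subrK. Qed.

Lemma natiso_faithful (C : preadditive) (F : functor C C) :
  naturally_isomorphic F (functor_id C) -> faithful F.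
Proof.
move=> [eta [isoeta nateta]] x y f g fg.
apply: (isomorphism_epi (isoeta x)).
by have := nateta _ _ f; rewrite fg nateta /= => ->.
Qed.

Lemma equivalence_weak (C D : preadditive) (F : functor C D) :
  equivalence F -> weak_equivalence F.
Proof.
move=> [G [GF FG]].
have fG : faithful G.
  by move=> x y f g fg; apply: (natiso_faithful FG); rewrite /= fg.
split.
- by move=> x y f g fg; apply: (natiso_faithful GF); rewrite /= fg.
- move=> x y g; have [eta [isoeta nateta]] := GF.
  have [ix [ix1 ix2]] := isoeta x.
  exists (mcomp (mcomp (eta y) (fmap G g)) ix); apply: fG.
  apply: (isomorphism_mono (isoeta y)).
  by rewrite [LHS]nateta /= -!compA ix1 compm1.
- move=> y; have [eps [isoeps _]] := FG; exists (G y), (eps y); exact: isoeps.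
Qed.

(** Choice selects an isomorphism [eps y] onto each [y]; conjugating by [eps] and taking the unique
    preimage under [F] defines the quasi-inverse, and makes [eps] natural. *)
Lemma weak_equivalence_equivalence (C D : preadditive) (F : functor C D) :
  weak_equivalence F -> equivalence F.
Proof.
move=> [fF uF sF].
have inv (y : D) : exists t : {x : C & mor (F x) y}, isomorphism (tagged t).
  by have [x [i isoi]] := sF y; exists (Tagged (fun x => mor (F x) y) i).
pose G0 y := tag (sval (cid (inv y))).
pose eps y : mor (F (G0 y)) y := tagged (sval (cid (inv y))).
have isoeps y : isomorphism (eps y) := svalP (cid (inv y)).
pose eps' y := sval (cid (isoeps y)).
have epsK y : mcomp (eps' y) (eps y) = idm _ := (svalP (cid (isoeps y))).1.
have epsK' y : mcomp (eps y) (eps' y) = idm _ := (svalP (cid (isoeps y))).2.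
pose G1 x y (f : mor x y) := sval (cid (uF _ _ (mcomp (eps' y) (mcomp f (eps x))))).
have G1E x y (f : mor x y) : fmap F (G1 x y f) = mcomp (eps' y) (mcomp f (eps x)).
  by exact: (svalP (cid (uF _ _ _))).
have G11 y : G1 y y (idm y) = idm (G0 y).
  by apply: fF; rewrite G1E comp1m epsK fmap1.
have G1M x y z (g : mor y z) (f : mor x y) :
    G1 x z (mcomp g f) = mcomp (G1 y z g) (G1 x y f).
  apply: fF; rewrite fmapM !G1E -!compA; congr mcomp; congr mcomp.
  by rewrite !compA epsK' comp1m.
exists (Functor G11 G1M); split.
  pose eta x : mor (G0 (F x)) x := sval (cid (uF _ _ (eps (F x)))).
  have etaE x : fmap F (eta x) = eps (F x) := svalP (cid (uF _ _ (eps (F x)))).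
  exists eta; split=> [x|x y f].
    have [e ee] := uF _ _ (eps' (F x)).
    by exists e; split; apply: fF; rewrite fmapM ee etaE fmap1 ?epsK ?epsK'.
  by apply: fF; rewrite [LHS]fmapM fmapM /= G1E !etaE compA epsK' comp1m.
by exists eps; split=> // x y f; rewrite /= G1E compA epsK' comp1m.
Qed.

Lemma weak_equivalence_comp (C D E : preadditive) (G : functor D E)
    (F : functor C D) :
  weak_equivalence G -> weak_equivalence F ->
  weak_equivalence (functor_comp G F).
Proof.
move=> [fG uG sG] [fF uF sF]; split.
- by move=> x y f g /fG/fF.
- move=> x y h; have [g <-] := uG _ _ h; have [f <-] := uF _ _ g.
  by exists f.
- move=> z; have [y [i [i' [i'i ii']]]] := sG z; have [x [j isoj]] := sF y.
  have [k [kj jk]] := fmap_iso G isoj.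
  exists x, (mcomp i (fmap G j)), (mcomp k i'); split.
    by rewrite compA -(compA k) i'i compm1.
  by rewrite compA -(compA i) jk compm1.
Qed.

(** Naturality of [eps] makes [F (G h)] the conjugate of [h] by [eps], which is additive in [h];
    faithfulness of [F] then gives additivity of [G]. *)
Lemma weak_equivalence_inverse (C D : preadditive) (F : functor C D) :
  additive_functor F -> weak_equivalence F ->
  exists G : functor D C, additive_functor G /\ weak_equivalence G.
Proof.
move=> addF wF; have [fF _ _] := wF.
have [G [GF FG]] := weak_equivalence_equivalence wF.
exists G; split; last by apply: equivalence_weak; exists F.
move=> x y f g; apply: fF; have [eps [isoeps nateps]] := FG.
apply: (isomorphism_mono (isoeps y)).
have H a b (h : mor a b) :
  mcomp (eps b) (fmap F (fmap G h)) = mcomp h (eps a) := nateps a b h.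
by rewrite addF compDr !H compDl.
Qed.

Lemma dualityP (C D : preadditive) :
  duality C D <->
  exists F : functor (opcat C) D, additive_functor F /\ weak_equivalence F.
Proof.
by split=> -[F [addF eF]]; exists F; split=> //;
  [exact: equivalence_weak | exact: weak_equivalence_equivalence].
Qed.

(** * Properties carried along an equivalence *)

Section Transfer.
Variables (C D : preadditive) (F : functor C D).
Hypothesis wF : weak_equivalence F.

Lemma fmap_epi (x y : C) (f : mor x y) : epimorphism f -> epimorphism (fmap F f).
Proof.
have [fF uF sF] := wF; move=> epif z g h.
(* Replacing [z] by an isomorphic [F w] lets fullness turn the test morphisms into morphisms of
   [C]. *)
have [w [i [i' [i'i ii']]]] := sF z.
have [g' g'E] := uF _ _ (mcomp i' g); have [h' h'E] := uF _ _ (mcomp i' h) => e.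
have : g' = h'.
  by apply: epif; apply: fF; rewrite !fmapM g'E h'E -!compA e.
move=> /(congr1 (fmap F)); rewrite g'E h'E => /(congr1 (mcomp i)).
by rewrite !compA ii' !comp1m.
Qed.

Lemma fmap_projective (x : C) : projective_object (F x) <-> projective_object x.
Proof.
have [fF uF sF] := wF; split=> px a b q epiq f.
  have [g gE] := px _ _ _ (fmap_epi epiq) (fmap F f).
  have [g' g'E] := uF _ _ g.
  by exists g'; apply: fF; rewrite fmapM g'E.
have [a' [i [i' [i'i ii']]]] := sF a.
have [b' [j [j' [j'j jj']]]] := sF b.
have [q' q'E] := uF _ _ (mcomp j' (mcomp q i)).
have [f' f'E] := uF _ _ (mcomp j' f).
have epiq' : epimorphism q'.
  move=> z g h /(congr1 (fmap F)); rewrite !fmapM q'E !compA => e.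
  have isoi : isomorphism i by exists i'.
  have isoj' : isomorphism j' by exists j.
  apply: fF; apply: (isomorphism_epi isoj'); apply: epiq.
  exact: (isomorphism_epi isoi).
have [g gE] := px _ _ _ epiq' f'.
exists (mcomp i (fmap F g)); move/(congr1 (fmap F)): gE.
rewrite fmapM q'E f'E => /(congr1 (mcomp j)).
by rewrite !compA jj' !comp1m.
Qed.

(** This is what a duality carries over from one module category: read in the opposite category it
    gives weak kernels, from which finite generation of submodules follows. *)
Definition weak_cokernels (A : preadditive) : Prop :=
  forall (x y : A) (f : mor x y), exists (z : A) (c : mor y z),
    mcomp c f = 0 /\
    forall w (g : mor y w), mcomp g f = 0 -> exists h, mcomp h c = g.

Lemma weak_cokernels_transfer :
  additive_functor F -> weak_cokernels D -> weak_cokernels C.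
Proof.
have [fF uF sF] := wF; move=> addF wcD x y f.
have [z [c [cf0 cU]]] := wcD _ _ (fmap F f).
have [z' [i [i' [i'i ii']]]] := sF z.
have [c' c'E] := uF _ _ (mcomp i' c).
exists z', c'; split.
  by apply: fF; rewrite fmapM c'E -compA cf0 mcompm0 fmap0.
move=> w g gf0; have [|h hE] := cU _ (fmap F g).
  by rewrite -fmapM gf0 fmap0.
have [h' h'E] := uF _ _ (mcomp h i).
by exists h'; apply: fF; rewrite fmapM h'E c'E compA -(compA h) ii' compm1.
Qed.

End Transfer.

(** Closure of [QD] under isomorphism serves essential surjectivity: if [F x] is isomorphic to an
    object satisfying [QD], then [x] satisfies [QC]. *)
Lemma weak_equivalence_fullsub (C D : preadditive) (PC QC : C -> Prop)
    (PD QD : D -> Prop) (F : functor (opcat (fullsub PC)) (fullsub PD)) :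
  additive_functor F -> weak_equivalence F ->
  (forall x : fullsub PC, QC (sval x) <-> QD (sval (F x))) ->
  (forall x y : fullsub PD, forall i : mor x y, isomorphism i ->
     QD (sval y) -> QD (sval x)) ->
  exists F' : functor (opcat (fullsub (fun x => PC x /\ QC x)))
                      (fullsub (fun x => PD x /\ QD x)),
    additive_functor F' /\ weak_equivalence F'.
Proof.
move=> addF [fF uF sF] QF isoQ.
(* [svalP] and [proj1] are opaque and would block the conversions below. *)
pose und (x : opcat (fullsub (fun x => PC x /\ QC x))) : opcat (fullsub PC) :=
  exist _ (sval x) (let: conj Px _ := proj2_sig x in Px).
have undQ x : QD (sval (F (und x))) by apply/QF; exact: (svalP x).2.
pose F0 x : fullsub (fun x => PD x /\ QD x) :=
  exist _ (sval (F (und x))) (conj (svalP (F (und x))) (undQ x)).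
exists (@Functor _ (fullsub (fun x => PD x /\ QD x)) F0
   (fun x y f => @fmap _ _ F (und x) (und y) f)
   (fun x => fmap1 F (und x))
   (fun x y z g f => @fmapM _ _ F (und x) (und y) (und z) g f)).
split; first by move=> x y f g; exact: (addF (und x) (und y)).
split.
- by move=> x y f g; exact: (fF (und x) (und y)).
- by move=> x y g; exact: (uF (und x) (und y)).
- move=> y; pose y' : fullsub PD :=
    exist _ (sval y) (let: conj Py _ := proj2_sig y in Py).
  have [x [i isoi]] := sF y'.
  have Qx : QC (sval x) by apply/QF; apply: isoQ isoi _; exact: (svalP y).2.
  case: x i isoi Qx => x Px i isoi Qx.
  by exists (exist _ x (conj Px Qx)), i.
Qed.

Lemma weak_kernels_of_op (A : preadditive) : weak_cokernels (opcat A) ->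
  forall (x y : A) (f : mor x y), exists (z : A) (c : mor z x),
    mcomp f c = 0 /\
    forall w (g : mor w x), mcomp f g = 0 -> exists h, mcomp c h = g.
Proof. by move=> wc x y f; exact: (wc y x f). Qed.

Lemma fmap_op_projective (A B : preadditive) (F : functor (opcat A) B) :
  weak_equivalence F ->
  forall x : A, projective_object (F x) <-> injective_object x.
Proof.
move=> wF x; apply: iff_trans (fmap_projective wF x) _.
by split=> ix a b; exact: (ix b a).
Qed.

(** * Submodules, quotients and projective covers *)

Section Homomorphisms.
Variable R : rngType.

Definition modhom_of (M N : rngModType R) (f : M -> N) (homf : is_modhom f) :
  modhom M N := ModHom (introT (asboolP _) homf).

Section Basics.
Variables (M N : rngModType R) (f : modhom M N).

Lemma modhomD : {morph f : x y / x + y}.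
Proof. exact: (modhomP f).1. Qed.

Lemma modhomZ a : {morph f : x / rngact a x}.
Proof. exact: (modhomP f).2. Qed.

Lemma modhom0 : f 0 = 0.
Proof. by apply: (addrI (f 0)); rewrite -modhomD !addr0. Qed.

Lemma modhomN : {morph f : x / - x}.
Proof. by move=> x; apply: (addrI (f x)); rewrite -modhomD !subrr modhom0. Qed.

Lemma modhomB : {morph f : x y / x - y}.
Proof. by move=> x y; rewrite modhomD modhomN. Qed.

Lemma rngact0l (m : M) : rngact (0 : R) m = 0.
Proof. by apply: (addrI (rngact 0 m)); rewrite -rngactDl !addr0. Qed.

Lemma submoduleD (P : M -> Prop) m n : submodule P -> P m -> P n -> P (m + n).
Proof.
move=> [P0 PB _] Pm Pn; rewrite -[n]opprK; apply: (PB) => //.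
by rewrite -sub0r; apply: (PB).
Qed.

Lemma submodule_ker : submodule (fun x => f x = 0).
Proof.
split=> [|m n fm fn|r m fm]; first exact: modhom0.
  by rewrite modhomB fm fn subr0.
by rewrite modhomZ fm rngact0.
Qed.

Lemma submodule_preim (P : N -> Prop) : submodule P -> submodule (fun x => P (f x)).
Proof.
by move=> [P0 PB PZ]; split=> *; rewrite ?modhom0 ?modhomB ?modhomZ; auto.
Qed.

Lemma submodule_img : submodule (fun y => exists x, f x = y).
Proof.
split=> [|_ _ [x <-] [y <-]|r _ [x <-]]; first by exists 0; rewrite modhom0.
  by exists (x - y); rewrite modhomB.
by exists (rngact r x); rewrite modhomZ.
Qed.

End Basics.

Definition surjective_fun (A B : Type) (f : A -> B) := forall y, exists x, f x = y.

Lemma modhom_inj (M N : rngModType R) (f : modhom M N) :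
  (forall x, f x = 0 -> x = 0) -> injective f.
Proof.
by move=> f0 x y fxy; apply/subr0_eq/f0; rewrite modhomB fxy subrr.
Qed.

Lemma modhom_corestrict (L M X : rngModType R) (i : modhom L M) (f : modhom X M) :
  injective i -> (forall x, exists l, i l = f x) ->
  exists g : modhom X L, forall x, i (g x) = f x.
Proof.
move=> inji /choice[g gE].
have homg : is_modhom g.
  by split=> *; apply: inji; rewrite ?modhomD ?modhomZ !gE ?modhomD ?modhomZ.
by exists (modhom_of homg).
Qed.

Lemma modhom_descend (X Y Z : rngModType R) (p : modhom X Z) (f : modhom X Y) :
  surjective_fun p -> (forall x, p x = 0 -> f x = 0) ->
  exists g : modhom Z Y, forall x, g (p x) = f x.
Proof.
move=> /choice[s sK] kerp.
have pf x y : p x = p y -> f x = f y.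
  by move=> pxy; apply/subr0_eq; rewrite -modhomB kerp // modhomB pxy subrr.
have homg : is_modhom (f \o s).
  by split=> * /=; rewrite -?modhomD -?modhomZ;
     apply: pf; rewrite ?modhomD ?modhomZ !sK.
by exists (modhom_of homg) => x /=; apply: pf; rewrite sK.
Qed.

Lemma fg_surj (M N : rngModType R) (f : modhom M N) :
  surjective_fun f -> finitely_generated M -> finitely_generated N.
Proof.
move=> sf [s gs]; exists (map f s) => P subP Ps n; have [m <-] := sf n.
apply: (gs (fun m => P (f m))); first exact: submodule_preim.
by move=> x xs; apply: Ps; apply: map_f.
Qed.

Lemma unitary_surj (M N : rngModType R) (f : modhom M N) :
  surjective_fun f -> unitary M -> unitary N.
Proof.
move=> sf uM n; have [m <-] := sf n; have [s ->] := uM m.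
exists [seq (p.1, f p.2) | p <- s]; rewrite big_map /=.
by rewrite (big_morph f (modhomD f) (modhom0 f)); apply: eq_bigr => p _;
   rewrite modhomZ.
Qed.

End Homomorphisms.

(** * Submodules and quotient modules *)

Section Submodule.
Variables (R : rngType) (M : rngModType R) (P : M -> Prop) (subP : submodule P).

Definition submod_pred of submodule P : {pred M} := fun x => `[< P x >].

Fact submod_zmod_closed : zmod_closed (submod_pred subP).
Proof.
have [P0 PB _] := subP; split; first exact/asboolP.
by move=> x y /asboolP Px /asboolP Py; apply/asboolP/PB.
Qed.
HB.instance Definition _ :=
  GRing.isZmodClosed.Build M (submod_pred subP) submod_zmod_closed.

Record submod := Submod {submod_val :> M; _ : submod_val \in submod_pred subP}.

HB.instance Definition _ := [isSub for submod_val].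
HB.instance Definition _ := [Choice of submod by <:].
HB.instance Definition _ := [SubChoice_isSubZmodule of submod by <:].

Fact submod_act_subproof (r : R) (x : submod) :
  rngact r (val x) \in submod_pred subP.
Proof. by have [_ _ PZ] := subP; apply/asboolP/PZ/asboolP/(valP x). Qed.

Definition submod_act r x := Submod (submod_act_subproof r x).

Fact submod_actA a b x :
  submod_act (rngmul a b) x = submod_act a (submod_act b x).
Proof. by apply: val_inj; apply: rngactA. Qed.

Fact submod_actDl a b x : submod_act (a + b) x = submod_act a x + submod_act b x.
Proof. by apply: val_inj; apply: rngactDl. Qed.

Fact submod_actDr a x y : submod_act a (x + y) = submod_act a x + submod_act a y.
Proof. by apply: val_inj; apply: rngactDr. Qed.

HB.instance Definition _ :=
  Zmodule_isRngModule.Build R submod submod_actA submod_actDl submod_actDr.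

(** Below, submodules appear only as injective homomorphisms and quotients only as surjective ones;
    the carriers built here stay local. *)
Lemma submodule_inclusion :
  exists (L : rngModType R) (i : modhom L M),
    injective i /\ forall m, P m <-> exists x, i x = m.
Proof.
have homv : is_modhom submod_val by [].
exists submod, (modhom_of homv); split; first exact: val_inj.
move=> m; split=> [Pm|[x <-]]; last exact/asboolP/(valP x).
by exists (Submod (introT (asboolP _) Pm)).
Qed.

Local Open Scope quotient_scope.

Local Notation Q := (Quotient.quot (submod_pred subP)).

Definition quotmod_act (r : R) (x : Q) : Q := \pi_Q (rngact r (repr x)).

Lemma pi_eqP x y : (\pi_Q x = \pi_Q y) <-> P (x - y).
Proof.
split=> [/eqP|Pxy]; last apply/eqP; rewrite -Quotient.idealrBE; last exact/asboolP.
by move/asboolP.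
Qed.

Fact quotmod_actE r x : quotmod_act r (\pi_Q x) = \pi_Q (rngact r x).
Proof.
apply/pi_eqP; have [_ _ PZ] := subP; rewrite -rngactN -rngactDr; apply: PZ.
by apply/pi_eqP; rewrite reprK.
Qed.

Fact quotmod_actA a b x :
  quotmod_act (rngmul a b) x = quotmod_act a (quotmod_act b x).
Proof. by elim/quotW: x => x; rewrite (quotmod_actE b) !quotmod_actE rngactA. Qed.

Fact quotmod_actDl a b x :
  quotmod_act (a + b) x = quotmod_act a x + quotmod_act b x.
Proof. by elim/quotW: x => x; rewrite !quotmod_actE rngactDl raddfD. Qed.

Fact quotmod_actDr a x y :
  quotmod_act a (x + y) = quotmod_act a x + quotmod_act a y.
Proof.
elim/quotW: x => x; elim/quotW: y => y.
by rewrite !quotmod_actE -!raddfD quotmod_actE rngactDr.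
Qed.

HB.instance Definition _ :=
  Zmodule_isRngModule.Build R Q quotmod_actA quotmod_actDl quotmod_actDr.

Lemma quotient_module :
  exists (Z : rngModType R) (p : modhom M Z),
    surjective_fun p /\ forall m, p m = 0 <-> P m.
Proof.
have homp : is_modhom (fun x => \pi_Q x).
  by split=> [x y|r x]; rewrite ?raddfD // -quotmod_actE.
exists Q, (modhom_of homp); split.
  by move=> y; exists (repr y); apply: reprK.
move=> m; rewrite -[m in P m]subr0 -pi_eqP /= raddf0; exact: iff_refl.
Qed.

End Submodule.

(** * Local units and projective covers *)

Section Rng.
Variable R : rngType.

Lemma rngmul0r (a : R) : rngmul 0 a = 0.
Proof. by apply: (addrI (rngmul 0 a)); rewrite -rngmulDl !addr0. Qed.

Lemma rngmulr0 (a : R) : rngmul a 0 = 0.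
Proof. by apply: (addrI (rngmul a 0)); rewrite -rngmulDr !addr0. Qed.

Lemma rngmulNr (a b : R) : rngmul (- a) b = - rngmul a b.
Proof. by apply: (addrI (rngmul a b)); rewrite -rngmulDl !subrr rngmul0r. Qed.

Lemma modhom_sum (M N : rngModType R) (f : modhom M N) I (r : seq I) (F : I -> M) :
  f (\sum_(i <- r) F i) = \sum_(i <- r) f (F i).
Proof. exact: (big_morph f (modhomD f) (modhom0 f)). Qed.

Lemma rngact_sumr (M : rngModType R) (a : R) I (r : seq I) (F : I -> M) :
  rngact a (\sum_(i <- r) F i) = \sum_(i <- r) rngact a (F i).
Proof. exact: (big_morph (rngact a) (rngactDr a) (rngact0 M a)). Qed.

Lemma submodule_sum (M : rngModType R) (P : M -> Prop) I (r : seq I) (F : I -> M) :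
  submodule P -> (forall i, P (F i)) -> P (\sum_(i <- r) F i).
Proof.
move=> subP PF; apply: big_ind => // [|x y]; first by case: subP.
exact: submoduleD.
Qed.

Section Free.
Variable n : nat.
Implicit Type c : {ffun 'I_n -> R}.

Definition free_act (a : R) c : {ffun 'I_n -> R} := [ffun i => rngmul a (c i)].

Fact free_actA a b c : free_act (rngmul a b) c = free_act a (free_act b c).
Proof. by apply/ffunP => i; rewrite !ffunE rngmulA. Qed.

Fact free_actDl a b c : free_act (a + b) c = free_act a c + free_act b c.
Proof. by apply/ffunP => i; rewrite !ffunE rngmulDl. Qed.

Fact free_actDr a c d : free_act a (c + d) = free_act a c + free_act a d.
Proof. by apply/ffunP => i; rewrite !ffunE rngmulDr. Qed.

HB.instance Definition _ := Zmodule_isRngModule.Build R {ffun 'I_n -> R}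
  free_actA free_actDl free_actDr.

Definition free_module : rngModType R := {ffun 'I_n -> R}.

Fact lincomb_is_modhom (X : rngModType R) (t : 'I_n -> X) :
  @is_modhom R free_module X (fun c : {ffun _} => \sum_i rngact (c i) (t i)).
Proof.
split=> [c d|a c]; last first.
  by rewrite rngact_sumr; apply: eq_bigr => i _; rewrite ffunE rngactA.
by rewrite -big_split; apply: eq_bigr => i _; rewrite ffunE rngactDl.
Qed.

Definition lincomb (X : rngModType R) (t : 'I_n -> X) : modhom free_module X :=
  modhom_of (lincomb_is_modhom t).

End Free.

Definition projective_mod (P : rngModType R) : Prop :=
  forall (X Y : rngModType R) (q : modhom X Y), unitary X -> unitary Y ->
    surjective_fun q -> forall f : modhom P Y,
    exists g : modhom P X, forall x, q (g x) = f x.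

Section LocalUnits.
Hypothesis luR : local_units R.

Lemma left_unit_seq (s : seq R) :
  exists e, rngmul e e = e /\ forall x, x \in s -> rngmul e x = x.
Proof.
have [e [ee es]] := luR s; exists e; split=> // x /es[r ->].
by rewrite !rngmulA ee.
Qed.

(** Each element of [s] is a finite sum of products [r m]; an idempotent fixing all these
    coefficients [r] from the left fixes [s]. *)
Lemma unitary_left_unit (M : rngModType R) (s : seq M) :
  unitary M -> exists e : R, rngmul e e = e /\ forall x, x \in s -> rngact e x = x.
Proof.
move=> uM.
have [c cP] : exists c : seq R, forall e : R, rngmul e e = e ->
    (forall r, r \in c -> rngmul e r = r) -> forall x, x \in s -> rngact e x = x.
  elim: s => [|m s [c cP]]; first by exists [::].
  have [t mE] := uM m; exists (map fst t ++ c) => e ee ec x.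
  rewrite inE => /orP[/eqP ->{x}|]; last first.
    by apply: cP => // r rc; apply: ec; rewrite mem_cat rc orbT.
  rewrite mE rngact_sumr; apply: eq_big_seq => p pt.
  by rewrite -rngactA ec // mem_cat map_f.
have [e [ee ec]] := left_unit_seq c; exists e; split=> //.
exact: cP.
Qed.

Lemma unitary_inj (L M : rngModType R) (i : modhom L M) :
  injective i -> unitary M -> unitary L.
Proof.
move=> inji uM x; have [e [ee ex]] := unitary_left_unit [:: i x] uM.
exists [:: (e, x)]; rewrite big_seq1 /=; apply: inji.
by rewrite modhomZ ex // mem_head.
Qed.

(* [Q] is [(Re)^n], where [n] is the size of [s] and [e] fixes [s]. *)
Lemma projective_cover (M : rngModType R) (s : seq M) : unitary M ->
  exists (Q : rngModType R) (h : modhom Q M),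
    [/\ unitary Q, finitely_generated Q, projective_mod Q,
        forall x, x \in s -> exists z, h z = x
      & forall P : M -> Prop, submodule P -> (forall x, x \in s -> P x) ->
          forall z, P (h z)].
Proof.
move=> uM; have [e [ee es]] := unitary_left_unit s uM.
set n := size s.
have subRe : @submodule R (free_module n)
    (fun c : {ffun _} => forall i, rngmul (c i) e = c i).
  split=> [i|c d ce de i|r c ce i]; rewrite !ffunE.
  - exact: rngmul0r.
  - by rewrite rngmulDl rngmulNr ce de.
  - by rewrite -rngmulA ce.
have [Q [i [inji iQ]]] := submodule_inclusion subRe.
(* Vectors with [e] in one place and 0 elsewhere act as a standard basis; they lie in [(Re)^n]
   because [e] is idempotent. *)
have /choice[b bE] : forall j : 'I_n, exists x : Q,
    i x = [ffun k => if k == j then e else 0] :> {ffun _}.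
  move=> j; apply/iQ => k; rewrite ffunE.
  by case: eqP => _; rewrite ?ee ?rngmul0r.
have genQ z : z = \sum_j rngact ((i z : {ffun _}) j) (b j).
  apply: inji; rewrite modhom_sum; apply/ffunP => k.
  have /(_ k) ize : forall k, rngmul ((i z : {ffun _}) k) e = (i z : {ffun _}) k.
    by apply/iQ; exists z.
  rewrite sum_ffunE (bigD1 k) //= big1 => [|j /negbTE jk];
    rewrite modhomZ bE !ffunE ?eqxx ?ize ?addr0 //.
  by rewrite eq_sym jk rngmulr0.
have lincombE (X : rngModType R) (t : 'I_n -> X) j :
    lincomb t (i (b j)) = rngact e (t j).
  rewrite bE /= (bigD1 j) //= big1 ?ffunE ?eqxx ?addr0 // => k /negbTE kj.
  by rewrite ffunE kj rngact0l.
exists Q, (modhom_comp (lincomb (fun j : 'I_n => nth 0 s j)) i); split.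
- move=> z; exists [seq ((i z : {ffun _}) j, b j) | j <- index_enum 'I_n].
  by rewrite big_map; exact: genQ.
- exists (codom b) => P subP Pb z; rewrite (genQ z).
  apply: submodule_sum => // j; have [_ _ PZ] := subP; apply: PZ.
  by apply: Pb; exact: codom_f.
(* Arbitrary preimages [x j] of [f (b j)] suffice: combining them with the coordinates of [z] gives
   an element that [q] sends to [f z]. *)
- move=> X Y q uX uY sq f.
  have [x xE] := choice (fun j => sq (f (b j))).
  exists (modhom_comp (lincomb x) i) => z.
  rewrite [in RHS](genQ z) /= !modhom_sum; apply: eq_bigr => j _.
  by rewrite !modhomZ xE.
- move=> x xs; have xn : (index x s < n)%N by rewrite index_mem.
  by exists (b (Ordinal xn)); rewrite [LHS]lincombE /= nth_index // es.
- move=> P subP Ps z /=; apply: submodule_sum => // j.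
  by have [_ _ PZ] := subP; apply: PZ; apply: Ps; apply: mem_nth.
Qed.

(** Both maps are corestricted to the image of [q], where [q] becomes surjective; this image is
    unitary as a submodule of [Y]. *)
Lemma projective_lift (P X Y : rngModType R) (f : modhom P Y) (q : modhom X Y) :
  projective_mod P -> unitary X -> unitary Y ->
  (forall x, exists z, q z = f x) -> exists g : modhom P X, forall x, q (g x) = f x.
Proof.
move=> projP uX uY fq.
have [I [i [inji iI]]] := submodule_inclusion (submodule_img q).
have [f' f'E] : exists f' : modhom P I, forall x, i (f' x) = f x.
  by apply: modhom_corestrict => // x; apply/iI.
have [q' q'E] : exists q' : modhom X I, forall x, i (q' x) = q x.
  by apply: modhom_corestrict => // x; apply/iI; exists x.
have sq' : surjective_fun q'.
  move=> y; have [|x xE] := (iI (i y)).2; first by exists y.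
  by exists x; apply: inji; rewrite q'E.
have [g gE] := projP _ _ q' uX (unitary_inj inji uY) sq' f'.
by exists g => x; rewrite -q'E gE f'E.
Qed.

Lemma projective_retract (P Q : rngModType R) (r : modhom Q P) (s : modhom P Q) :
  (forall x, r (s x) = x) -> projective_mod Q -> projective_mod P.
Proof.
move=> rs projQ X Y q uX uY sq f.
have [g gE] := projQ _ _ q uX uY sq (modhom_comp f r).
by exists (modhom_comp g s) => x; rewrite /= gE /= rs.
Qed.

End LocalUnits.
End Rng.

(** * Baer's criterion *)

Section Injectivity.
Variable R : rngType.
Hypothesis luR : local_units R.

Definition extends_along (E L X : rngModType R) (i : modhom L X) : Prop :=
  forall f : modhom L E, exists g : modhom X E, forall x, g (i x) = f x.

Section Baer.
Variables (E L Y : rngModType R) (i : modhom L Y) (f : modhom L E).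
Hypotheses (inji : injective i) (uY : unitary Y).
Hypothesis extE : forall (L X : rngModType R) (i : modhom L X),
  injective i -> unitary X -> finitely_generated X -> extends_along E i.

(* Graph of a homomorphism to [E] from a submodule of [Y] that extends [f]; the
   empty graph is allowed so that the empty chain has a union in this class. *)
Definition partial_extension (G : set (Y * E)) : Prop :=
  [/\ forall a b, G a -> G b -> G (a.1 - b.1, a.2 - b.2),
      forall r a, G a -> G (rngact r a.1, rngact r a.2),
      forall u, G (0, u) -> u = 0
    & forall a, G a -> forall x, G (i x, f x)].

Lemma partial_extension_bigcup (F : set (set (Y * E))) :
  (F `<=` partial_extension)%classic -> total_on F subset ->
  partial_extension (\bigcup_(G in F) G)%classic.
Proof.
move=> FP Ftot; split.
- move=> a b [G FG Ga] [H FH Hb].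
  have [GH|HG] := Ftot _ _ FG FH.
    by exists H => //; have [HB _ _ _] := FP _ FH; apply: HB => //; apply: GH.
  by exists G => //; have [GB _ _ _] := FP _ FG; apply: GB => //; apply: HG.
- by move=> r a [G FG Ga]; exists G => //; have [_ GZ _ _] := FP _ FG; exact: GZ.
- by move=> u [G FG Gu]; have [_ _ G0 _] := FP _ FG; exact: G0.
- by move=> a [G FG Ga] x; exists G => //; have [_ _ _ Gf] := FP _ FG; exact: Gf Ga x.
Qed.

(** A homomorphism [h] from a finitely generated [Q] reaches [y]. On the submodule [K] of [Q] that
    [h] sends into the domain of [G], the graph prescribes values, and [extE] extends them to [psi]
    on [Q]. *)
Lemma partial_extension_adjoin (G : set (Y * E)) (y : Y) :
  partial_extension G -> (exists a, G a) ->
  exists H, [/\ partial_extension H, (G `<=` H)%classic & exists u, H (y, u)].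
Proof.
move=> [GB GZ G1 Gf] [a0 Ga0].
have G00 : G (0, 0) by have := GB _ _ Ga0 Ga0; rewrite !subrr.
have GD a b : G a -> G b -> G (a.1 + b.1, a.2 + b.2).
  move=> Ga Gb; have := GB _ _ Ga (GB _ _ G00 Gb).
  by rewrite /= !sub0r !opprK.
have Guniq z u v : G (z, u) -> G (z, v) -> u = v.
  move=> Gu Gv; apply/subr0_eq/G1; have := GB _ _ Gu Gv.
  by rewrite /= subrr.
have [Q [h [uQ fgQ _ hy _]]] := projective_cover luR [:: y] uY.
have [w wy] := hy y (mem_head _ _).
have subK : submodule (fun z => exists u, G (h z, u)).
  split=> [|z z' [u Gu] [u' Gu']|r z [u Gu]].
  - by exists 0; rewrite modhom0.
  - by exists (u - u'); rewrite modhomB; exact: GB Gu Gu'.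
  - by exists (rngact r u); rewrite modhomZ; exact: GZ Gu.
have [K [j [injj jK]]] := submodule_inclusion subK.
have /choice[phi phiE] : forall k : K, exists u, G (h (j k), u).
  by move=> k; apply/jK; exists k.
have homphi : is_modhom phi.
  split=> [k l|r k]; apply: (Guniq _ _ _ (phiE _)).
    by rewrite !modhomD; exact: GD (phiE k) (phiE l).
  by rewrite !modhomZ; exact: GZ (phiE k).
have [psi psiE] := extE injj uQ fgQ (modhom_of homphi).
(* The sum of [G] and the pairs [(h z, psi z)] is single-valued because [psi] follows [G] on [K]. *)
exists (fun c => exists a z, G a /\ c = (a.1 + h z, a.2 + psi z)); split.
- split.
  + move=> _ _ [a [z [Ga ->]]] [b [z' [Gb ->]]].
    exists (a.1 - b.1, a.2 - b.2), (z - z'); split; first exact: GB.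
    by rewrite /= !modhomB !opprD !(addrACA _ _ (- _)).
  + move=> r _ [a [z [Ga ->]]]; exists (rngact r a.1, rngact r a.2), (rngact r z).
    by split; [exact: GZ | rewrite /= !modhomZ -!rngactDr].
  + move=> u [[y0 u0] [z [Ga [e ->]]]] /=.
    have [k kz] : exists k, j k = z.
      apply/jK; exists (- u0); have := GB _ _ G00 Ga; rewrite /= !sub0r.
      have -> // : h z = - y0.
      by apply/eqP; rewrite -addr_eq0 addrC -e.
    apply: G1; rewrite e -kz psiE.
    by have := GD _ _ Ga (phiE k); rewrite kz.
  + move=> _ [a [z [Ga _]]] x; exists (i x, f x), 0.
    by rewrite !modhom0 !addr0; split=> //; exact: Gf Ga x.
- by move=> a Ga; exists a, 0; split=> //; rewrite !modhom0 !addr0; case: a Ga.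
- by exists (0 + psi w), (0, 0), w; split; rewrite /= ?wy ?add0r.
Qed.

(** A maximal partial extension exists by Zorn's lemma, and adjoining elements shows that its domain
    is [Y]. Finitely generated unitary modules and their submodules play the part of the ring and
    its left ideals in the classical criterion. *)
Lemma baer : exists g : modhom Y E, forall x, g (i x) = f x.
Proof.
have [G [pG maxG]] := Zorn_bigcup partial_extension_bigcup.
have max H : partial_extension H -> (G `<=` H)%classic -> (H `<=` G)%classic.
  by move=> pH GH; apply: contrapT => nHG; exact: (maxG H (conj GH nHG)).
(* An empty maximal graph would be properly contained in the graph of [f] over [i]. *)
have G0 : exists a, G a.
  apply: contrapT => nG; apply: (nG); exists (i 0, f 0).
  apply: (max (fun a => exists x, a = (i x, f x))); last by exists 0.
  split=> [_ _ [x ->] [y ->]|r _ [x ->]|u [x [x0 ->]]|a _ x]; last by exists x.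
  - by exists (x - y); rewrite /= !modhomB.
  - by exists (rngact r x); rewrite /= !modhomZ.
  - by rewrite (inji (_ : i x = i 0)) ?modhom0.
  by move=> a Ga; case: nG; exists a.
have /choice[g gE] : forall y, exists u, G (y, u).
  move=> y; have [H [pH GH [u Hu]]] := partial_extension_adjoin y pG G0.
  by exists u; apply: max Hu.
have [GB GZ G1 Gf] := pG; have [a Ga] := G0.
have Guniq z u v : G (z, u) -> G (z, v) -> u = v.
  move=> Gu Gv; apply/subr0_eq/G1; have := GB _ _ Gu Gv.
  by rewrite /= subrr.
have homg : is_modhom g.
  split=> [y z|r y]; last by apply: Guniq (gE _) (GZ _ _ (gE y)).
  apply/eqP; rewrite -subr_eq; apply/eqP; apply: Guniq (GB _ _ (gE _) (gE z)) _.
  by rewrite /= addrK.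
by exists (modhom_of homg) => x /=; apply: Guniq (gE _) (Gf _ Ga x).
Qed.

End Baer.
End Injectivity.

(** * Injective and projective objects *)

Section ModuleCategory.
Variable R : rngType.

Definition to_Mod (M : rngModType R) (uM : unitary M) : Mod R :=
  exist (@unitary R) M uM.

Definition to_fgMod (M : rngModType R) (uM : unitary M)
  (fgM : finitely_generated M) : fgMod R := exist (@fg_in_Mod R) (to_Mod uM) fgM.

Definition Mod_module (X : Mod R) : rngModType R := sval X.

Definition Mod_hom (X Y : Mod R) (f : mor X Y) :
  modhom (Mod_module X) (Mod_module Y) := f.

Definition fgMod_module (X : fgMod R) : rngModType R := Mod_module (sval X).

Definition fgMod_hom (X Y : fgMod R) (f : mor X Y) :
  modhom (fgMod_module X) (fgMod_module Y) := f.

(** The hypothesis is applied to the projection onto the quotient by the image of [f]. Testing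
    against surjective [p] lets [Z] inherit unitarity and finite generation from [Y]. *)
Lemma surjective_of_cokernel (X Y : rngModType R) (f : modhom X Y) :
  (forall (Z : rngModType R) (p : modhom Y Z), surjective_fun p ->
     modhom_comp p f = modhom_comp 0 f -> p = 0) -> surjective_fun f.
Proof.
move=> epif; have [Z [p [sp kerp]]] := quotient_module (submodule_img f).
have p0 : p = 0.
  by apply: epif => //; apply: modhom_eq => x /=; apply/kerp; exists x.
by move=> y; apply/kerp; rewrite p0.
Qed.

Lemma surjective_epi (X Y Z : rngModType R) (f : modhom X Y) (g h : modhom Y Z) :
  surjective_fun f -> modhom_comp g f = modhom_comp h f -> g = h.
Proof.
move=> sf gh; apply: modhom_eq => y; have [x <-] := sf y.
exact: (congr1 (fun k : modhom X Z => k x) gh).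
Qed.

Lemma injective_mono (W X Y : rngModType R) (f : modhom X Y) (g h : modhom W X) :
  injective f -> modhom_comp f g = modhom_comp f h -> g = h.
Proof.
move=> injf gh; apply: modhom_eq => w; apply: injf.
exact: (congr1 (fun k : modhom W Y => k w) gh).
Qed.

Lemma Mod_epiP (X Y : Mod R) (f : mor X Y) :
  epimorphism f <-> surjective_fun (Mod_hom f).
Proof.
split=> [epif|sf Z g h]; last exact: surjective_epi.
apply: surjective_of_cokernel => Z p sp.
exact: (epif (to_Mod (unitary_surj sp (proj2_sig Y)))).
Qed.

Lemma fgMod_epiP (X Y : fgMod R) (f : mor X Y) :
  epimorphism f <-> surjective_fun (fgMod_hom f).
Proof.
split=> [epif|sf Z g h]; last exact: surjective_epi.
apply: surjective_of_cokernel => Z p sp.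
exact: (epif (to_fgMod (unitary_surj sp (proj2_sig (sval Y)))
                       (fg_surj sp (proj2_sig Y)))).
Qed.

Lemma fgMod_weak_cokernels : weak_cokernels (fgMod R).
Proof.
move=> X Y f.
have [Z [p [sp kerp]]] := quotient_module (submodule_img (fgMod_hom f)).
exists (to_fgMod (unitary_surj sp (proj2_sig (sval Y)))
                 (fg_surj sp (proj2_sig Y))), p.
split; first by apply: modhom_eq => x; apply/kerp; exists x.
move=> W g gf0.
have [x /kerp[y <-]|h hE] := modhom_descend (f := fgMod_hom g) sp.
  exact: (congr1 (fun k : modhom _ _ => k y) gf0).
by exists h; apply: modhom_eq.
Qed.

Lemma Mod_projectiveP (X : Mod R) :
  projective_object X <-> projective_mod (Mod_module X).
Proof.
split=> [pX A B q uA uB sq f|pX A B q /Mod_epiP sq f].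
  have /pX/(_ f)[g gE] : epimorphism (q : @mor (Mod R) (to_Mod uA) (to_Mod uB)).
    exact/Mod_epiP.
  by exists g => x; exact: (congr1 (fun k : modhom _ _ => k x) gE).
have [g gE] := pX _ _ _ (proj2_sig A) (proj2_sig B) sq f.
by exists g; apply: modhom_eq.
Qed.

Hypothesis luR : local_units R.

(** Projectivity among finitely generated modules already splits the cover [h] by a module that is
    projective against all unitary modules. *)
Lemma fgMod_projectiveP (X : fgMod R) :
  projective_object X <-> projective_mod (fgMod_module X).
Proof.
split=> [pX|pX A B q /fgMod_epiP sq f]; last first.
  have [g gE] := pX _ _ _ (proj2_sig (sval A)) (proj2_sig (sval B)) sq f.
  by exists g; apply: modhom_eq.
have [s gs] := proj2_sig X.
have [Q [h [uQ fgQ pQ hs _]]] := projective_cover luR s (proj2_sig (sval X)).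
have [|r rE] := pX (to_fgMod uQ fgQ) X h _ (idm X).
  by apply/fgMod_epiP; exact: (gs _ (submodule_img h)).
apply: (projective_retract (r := h) (s := r)) pQ => x.
exact: (congr1 (fun k : modhom _ _ => k x) rE).
Qed.

(** The kernel may fail to be finitely generated, so each of its elements is reached from a finitely
    generated module mapping into it. *)
Lemma injective_of_kernel (X Y : rngModType R) (f : modhom X Y) : unitary X ->
  (forall (Q : rngModType R) (h : modhom Q X), unitary Q -> finitely_generated Q ->
     modhom_comp f h = modhom_comp f 0 -> h = 0) -> injective f.
Proof.
move=> uX monof; apply: modhom_inj => x fx0.
have [Q [h [uQ fgQ _ hx kerh]]] := projective_cover luR [:: x] uX.
have [z <-] := hx x (mem_head _ _).
rewrite (monof _ h uQ fgQ) //; apply: modhom_eq => w /=.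
by rewrite modhom0 (kerh _ (submodule_ker f)) // => y; rewrite inE => /eqP->.
Qed.

Lemma Mod_monoP (X Y : Mod R) (f : mor X Y) :
  monomorphism f <-> injective (Mod_hom f).
Proof.
split=> [monof|injf Z g h]; last exact: injective_mono.
apply: injective_of_kernel (proj2_sig X) _ => Q h uQ _.
exact: (monof (to_Mod uQ)).
Qed.

Lemma fgMod_monoP (X Y : fgMod R) (f : mor X Y) :
  monomorphism f <-> injective (fgMod_hom f).
Proof.
split=> [monof|injf Z g h]; last exact: injective_mono.
apply: injective_of_kernel (proj2_sig (sval X)) _ => Q h uQ fgQ.
exact: (monof (to_fgMod uQ fgQ)).
Qed.

Definition locally_noetherian : Prop :=
  forall (L X : rngModType R) (i : modhom L X),
    injective i -> unitary X -> finitely_generated X -> finitely_generated L.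

(** A weak kernel of the projection of [X] onto its quotient by [L] is a finitely generated module
    mapping onto [L]. *)
Lemma weak_kernels_noetherian :
  weak_cokernels (opcat (fgMod R)) -> locally_noetherian.
Proof.
move=> /weak_kernels_of_op wk L X i inji uX fgX.
have [Z [p [sp kerp]]] := quotient_module (submodule_img i).
pose X' := to_fgMod uX fgX.
pose Z' := to_fgMod (unitary_surj sp uX) (fg_surj sp fgX).
pose p' : mor X' Z' := p.
have [W [c [pc0 cU]]] := wk X' Z' p'; pose c' : modhom (fgMod_module W) X := c.
have [k kE] : exists k : modhom (fgMod_module W) L, forall w, i (k w) = c' w.
  apply: modhom_corestrict => // w; apply/kerp.
  exact: (congr1 (fun h : modhom _ _ => h w) pc0).
apply: (@fg_surj _ _ _ k) (proj2_sig W) => x.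
(* Surjectivity of [k]: a finitely generated [Q] reaches [i x] with image in the kernel of [p], so
   its map to [X] factors through the weak kernel. *)
have [Q [h [uQ fgQ _ hx kerh]]] := projective_cover luR [:: i x] uX.
have [z zE] := hx _ (mem_head _ _).
have [|a aE] := cU (to_fgMod uQ fgQ) h.
  apply: modhom_eq => w; apply: (kerh _ (submodule_ker p)) => y.
  by rewrite inE => /eqP ->; apply/kerp; exists x.
exists (fgMod_hom a z); apply: inji; rewrite kE -zE.
exact: (congr1 (fun h : modhom _ _ => h z) aE).
Qed.

(** Monomorphisms are the injections in both categories. From right to left, Baer's criterion leaves
    injections into finitely generated modules, whose sources are finitely generated by [noeR]. *)
Lemma fgMod_injectiveP (X : fgMod R) : locally_noetherian ->
  injective_object (sval X) <-> injective_object X.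
Proof.
move=> noeR; split=> injX A B i.
  by move=> /fgMod_monoP monoi; apply: injX; apply/Mod_monoP.
move=> /Mod_monoP inji f.
have [|g gE] := @baer _ luR _ _ _ _ f inji (proj2_sig B).
  move=> L Y j injj uY fgY h.
  have uL := unitary_inj luR injj uY; have fgL := noeR _ _ _ injj uY fgY.
  have [|g gE] := injX (to_fgMod uL fgL) (to_fgMod uY fgY) j _ h.
    exact/fgMod_monoP.
  by exists g => x; exact: (congr1 (fun h : modhom _ _ => h x) gE).
by exists g; apply: modhom_eq.
Qed.

End ModuleCategory.

Lemma duality_fgInj_fgProj (R S : rngType) :
  local_units R -> local_units S ->
  duality (fgMod R) (fgMod S) -> duality (fgInj R) (fgProj S).
Proof.
move=> luR luS /dualityP[F [addF wF]]; apply/dualityP.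
have noeR : locally_noetherian R.
  apply: weak_kernels_noetherian => //.
  exact: weak_cokernels_transfer wF addF (@fgMod_weak_cokernels S).
have projP (Y : fgMod S) : projective_object (sval Y) <-> projective_object Y.
  exact: iff_trans (Mod_projectiveP _) (iff_sym (fgMod_projectiveP luS _)).
apply: (weak_equivalence_fullsub (QC := @injective_object (Mod R))
  (QD := @projective_object (Mod S)) addF wF).
- move=> X; apply: iff_trans (fgMod_injectiveP luR X noeR) _.
  exact: iff_trans (iff_sym (fmap_op_projective wF X)) (iff_sym (projP (F X))).
- move=> X Y i [j [ji ij]] /Mod_projectiveP pY; apply/Mod_projectiveP.
  apply: (projective_retract (r := fgMod_hom j) (s := fgMod_hom i)) pY => x.
  exact: (congr1 (fun h : modhom _ _ => h x) ji).
Qed.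

(** * Reconstructing the finitely generated modules from the projective ones *)

Section Correspondence.
(** An element of [X M M'] is a datum pairing [M] with [M']; [rel] tells which morphisms correspond
    relative to such data. *)
Variables (C D : preadditive) (X : C -> D -> Type).
Variable rel : forall M M' N N', X M M' -> X N N' -> mor M N -> mor M' N' -> Prop.
Hypothesis corr_l : forall M, exists M', inhabited (X M M').
Hypothesis corr_r : forall M', exists M, inhabited (X M M').
Hypothesis rel_l : forall M M' N N' (a : X M M') (b : X N N') (f : mor M N),
  exists f', rel a b f f'.
Hypothesis rel_r : forall M M' N N' (a : X M M') (b : X N N') (f' : mor M' N'),
  exists f, rel a b f f'.
Hypothesis rel0_l : forall M M' N N' (a : X M M') (b : X N N') f',
  rel a b 0 f' -> f' = 0.
Hypothesis rel0_r : forall M M' N N' (a : X M M') (b : X N N') f,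
  rel a b f 0 -> f = 0.
Hypothesis relB : forall M M' N N' (a : X M M') (b : X N N') f g f' g',
  rel a b f f' -> rel a b g g' -> rel a b (f - g) (f' - g').
Hypothesis rel1 : forall M M' (a : X M M'), rel a a (idm M) (idm M').
Hypothesis relM : forall L L' M M' N N' (a : X L L') (b : X M M') (c : X N N')
    g g' f f',
  rel b c g g' -> rel a b f f' -> rel a c (mcomp g f) (mcomp g' f').

Lemma correspondence_equivalence :
  exists F : functor C D, additive_functor F /\ weak_equivalence F.
Proof.
have uniql M M' N N' (a : X M M') (b : X N N') f f' g' :
    rel a b f f' -> rel a b f g' -> f' = g'.
  move=> rf rg; apply/subr0_eq/(rel0_l (a := a) (b := b)).
  by rewrite -(subrr f); exact: relB.
have uniqr M M' N N' (a : X M M') (b : X N N') f g f' :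
    rel a b f f' -> rel a b g f' -> f = g.
  move=> rf rg; apply/subr0_eq/(rel0_r (a := a) (b := b)).
  by rewrite -(subrr f'); exact: relB.
(* Sums come from differences: [f + g = f - ((f - f) - g)]. *)
have relD M M' N N' (a : X M M') (b : X N N') f g f' g' :
    rel a b f f' -> rel a b g g' -> rel a b (f + g) (f' + g').
  move=> rf rg; have := relB rf (relB (relB rf rf) rg).
  by rewrite !subrr !sub0r !opprK.
have ex M : exists _ : {M' : D & X M M'}, True.
  by have [M' [a]] := corr_l M; exists (Tagged (X M) a).
pose F0 M := tag (sval (cid (ex M))).
pose c M : X M (F0 M) := tagged (sval (cid (ex M))).
pose F1 M N f := sval (cid (rel_l (c M) (c N) f)).
have F1E M N f : rel (c M) (c N) f (F1 M N f) := svalP (cid (rel_l (c M) (c N) f)).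
have F11 M : F1 M M (idm M) = idm (F0 M) by exact: uniql (F1E _ _ _) (rel1 _).
have F1M L M N (g : mor M N) (f : mor L M) :
    F1 L N (mcomp g f) = mcomp (F1 M N g) (F1 L M f).
  exact: uniql (F1E _ _ _) (relM (F1E _ _ _) (F1E _ _ _)).
exists (Functor F11 F1M); split.
  move=> M N f g; apply: uniql (F1E _ _ _) _.
  by apply: relD; exact: F1E.
split.
- move=> M N f g /= fg; apply: uniqr (F1E _ _ f) _; rewrite fg; exact: F1E.
- move=> M N g; have [f rf] := rel_r (c M) (c N) g.
  by exists f; exact: uniql (F1E _ _ _) rf.
(* Both [M'] and [F0 M] are paired with [M]; the morphisms related to its identity in the two
   directions are mutually inverse. *)
- move=> M'; have [M [b]] := corr_r M'; exists M.
  have [i ri] := rel_l (c M) b (idm M); have [j rj] := rel_l b (c M) (idm M).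
  exists i, j; split.
    by have := relM rj ri; rewrite comp1m => /uniql; apply; exact: rel1.
  by have := relM ri rj; rewrite comp1m => /uniql; apply; exact: rel1.
Qed.

End Correspondence.

(** * Quotients of projectives described by sieves *)

Section ProjectiveCategory.
Variable R : rngType.
Hypothesis luR : local_units R.

Definition fgProj_module (P : fgProj R) : rngModType R := Mod_module (sval P).

Definition fgProj_hom (P Q : fgProj R) (f : mor P Q) :
  modhom (fgProj_module P) (fgProj_module Q) := f.

(** Stated on elements, since [M] is in general not an object of [fgProj R]. The killed morphisms
    form the sieve that records the kernel of [p]. *)
Definition kills (P Q : fgProj R) (M : rngModType R)
    (p : modhom (fgProj_module P) M) (h : mor Q P) : Prop :=
  forall x, p (fgProj_hom h x) = 0.

Lemma fgProj_homM (P Q T : fgProj R) (g : mor Q T) (f : mor P Q) x :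
  fgProj_hom (mcomp g f) x = fgProj_hom g (fgProj_hom f x).
Proof. by []. Qed.

Lemma fgProj_homB (P Q : fgProj R) (f g : mor P Q) x :
  fgProj_hom (f - g) x = fgProj_hom f x - fgProj_hom g x.
Proof. by []. Qed.

Lemma fgProj_hom_eq (P Q : fgProj R) (f g : mor P Q) :
  fgProj_hom f =1 fgProj_hom g -> f = g.
Proof. exact: modhom_eq. Qed.

Lemma fgProj_homK (P Q : fgProj R) (f : mor P Q) (g : mor Q P) :
  mcomp g f = idm P -> cancel (fgProj_hom f) (fgProj_hom g).
Proof. by move=> gf x; exact: (congr1 (fun h => fgProj_hom h x) gf). Qed.

Lemma fgProj_unitary (P : fgProj R) : unitary (fgProj_module P).
Proof. exact: (proj2_sig (sval P)). Qed.

Lemma fgProj_fg (P : fgProj R) : finitely_generated (fgProj_module P).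
Proof. by have [] := proj2_sig P. Qed.

Lemma fgProj_cover (M : rngModType R) (s : seq M) : unitary M ->
  exists (Q : fgProj R) (h : modhom (fgProj_module Q) M),
    (forall x, x \in s -> exists z, h z = x) /\
    forall P : M -> Prop, submodule P -> (forall x, x \in s -> P x) ->
      forall z, P (h z).
Proof.
move=> uM; have [Q [h [uQ fgQ pQ hs sh]]] := projective_cover luR s uM.
have pQ' : projective_object (to_Mod uQ) by apply/Mod_projectiveP.
by exists (exist _ (to_Mod uQ) (conj fgQ pQ')), h.
Qed.

Lemma fgProj_lift (P Q : fgProj R) (M : rngModType R)
    (f : modhom (fgProj_module P) M) (q : modhom (fgProj_module Q) M) :
  unitary M -> (forall x, exists z, q z = f x) ->
  exists g : mor P Q, forall x, q (fgProj_hom g x) = f x.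
Proof.
have [_ /Mod_projectiveP pP] := proj2_sig P => uM.
exact: (projective_lift luR pP (@fgProj_unitary Q) uM).
Qed.

(** One projective [Q] covers the images of generators of [Q1] and [Q2] while staying in the kernel
    of [p]; projectivity factors [h1] and [h2] through it. *)
Lemma kernel_directed (P Q1 Q2 : fgProj R) (M : rngModType R)
    (p : modhom (fgProj_module P) M) (h1 : mor Q1 P) (h2 : mor Q2 P) :
  kills p h1 -> kills p h2 ->
  exists (Q : fgProj R) (h : mor Q P) (a1 : mor Q1 Q) (a2 : mor Q2 Q),
    [/\ kills p h, mcomp h a1 = h1 & mcomp h a2 = h2].
Proof.
move=> k1 k2; have [[s1 g1] [s2 g2]] := (fgProj_fg Q1, fgProj_fg Q2).
have [Q [h [hs kerh]]] :=
  fgProj_cover (map (fgProj_hom h1) s1 ++ map (fgProj_hom h2) s2) (@fgProj_unitary P).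
have [|a1 a1E] := @fgProj_lift Q1 Q _ (fgProj_hom h1) h (@fgProj_unitary P).
  apply: (g1 (fun x => exists z, h z = fgProj_hom h1 x)) => [|x xs].
    exact: submodule_preim (submodule_img h).
  by apply: hs; rewrite mem_cat map_f.
have [|a2 a2E] := @fgProj_lift Q2 Q _ (fgProj_hom h2) h (@fgProj_unitary P).
  apply: (g2 (fun x => exists z, h z = fgProj_hom h2 x)) => [|x xs].
    exact: submodule_preim (submodule_img h).
  by apply: hs; rewrite mem_cat map_f ?orbT.
exists Q, h, a1, a2; split; [|exact: fgProj_hom_eq|exact: fgProj_hom_eq].
apply: (kerh (fun x => p x = 0)) => [|x]; first exact: submodule_ker.
by rewrite mem_cat => /orP[] /mapP[y _ ->]; [exact: k1 | exact: k2].
Qed.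

(* A directed sieve on [P] amounts to a submodule of [P], the union of the
   images of its members, hence to a quotient of [P]. *)
Lemma sieve_quotient (P : fgProj R) (I : forall Q : fgProj R, mor Q P -> Prop) :
  (exists Q (h : mor Q P), I Q h) ->
  (forall Q Q' (h : mor Q P) (a : mor Q' Q), I Q h -> I Q' (mcomp h a)) ->
  (forall Q1 Q2 (h1 : mor Q1 P) (h2 : mor Q2 P), I Q1 h1 -> I Q2 h2 ->
     exists (Q : fgProj R) (h : mor Q P) (a1 : mor Q1 Q) (a2 : mor Q2 Q),
       [/\ I Q h, mcomp h a1 = h1 & mcomp h a2 = h2]) ->
  exists (M : fgMod R) (p : modhom (fgProj_module P) (fgMod_module M)),
    surjective_fun p /\ forall Q (h : mor Q P), kills p h <-> I Q h.
Proof.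
move=> [Q0 [h0 I0]] IM Idir.
pose N x := exists Q (h : mor Q P) z, I Q h /\ fgProj_hom h z = x.
(* Directedness puts finitely many elements of [N] into the image of a single member of the
   sieve. *)
have Nseq (s : seq (fgProj_module P)) : (forall x, x \in s -> N x) ->
    exists Q (h : mor Q P),
      I Q h /\ forall x, x \in s -> exists z, fgProj_hom h z = x.
  elim: s => [_|x s IHs Ns]; first by exists Q0, h0.
  have [|Q1 [h1 [I1 s1]]] := IHs.
    by move=> y ys; apply: Ns; rewrite inE ys orbT.
  have [Q2 [h2 [z [I2 zx]]]] := Ns x (mem_head _ _).
  have [Q [h [a1 [a2 [Ih ha1 ha2]]]]] := Idir _ _ _ _ I1 I2.
  exists Q, h; split=> // y; rewrite inE => /orP[/eqP ->|/s1[w wy]].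
    by exists (fgProj_hom a2 z); rewrite -fgProj_homM ha2.
  by exists (fgProj_hom a1 w); rewrite -fgProj_homM ha1.
have subN : submodule N.
  split=> [|x y Nx Ny|r x [Q [h [z [Ih <-]]]]].
  - by exists Q0, h0, 0; rewrite modhom0.
  - have [|Q [h [Ih hs]]] := Nseq [:: x; y].
      by move=> w; rewrite !inE => /orP[] /eqP ->.
    have [|u <-] := hs x; first by rewrite !inE eqxx.
    have [|v <-] := hs y; first by rewrite !inE eqxx orbT.
    by exists Q, h, (u - v); rewrite modhomB.
  - by exists Q, h, (rngact r z); rewrite modhomZ.
have [Z [p [sp kerp]]] := quotient_module subN.
exists (to_fgMod (unitary_surj sp (@fgProj_unitary P))
                 (fg_surj sp (fgProj_fg P))), p.
split=> // Q h; split=> [kh|Ih x]; last by apply/kerp; exists Q, h, x.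
(* If [p] kills [h], generators of [Q] land in the image of one member [h'], so [h] factors through
   [h'] by projectivity. *)
have [s gs] := fgProj_fg Q.
have [|Q' [h' [Ih' hs]]] := Nseq (map (fgProj_hom h) s).
  by move=> _ /mapP[x _ ->]; apply/kerp; exact: kh.
have [|a aE] :=
  @fgProj_lift Q Q' _ (fgProj_hom h) (fgProj_hom h') (@fgProj_unitary P).
  apply: (gs (fun x => exists z, fgProj_hom h' z = fgProj_hom h x)) => [|x xs].
    exact: submodule_preim (submodule_img (fgProj_hom h')).
  by apply: hs; rewrite map_f.
have <- : mcomp h' a = h by exact: fgProj_hom_eq.
exact: IM.
Qed.

End ProjectiveCategory.

(** * Extending an equivalence from projectives to finitely generated modules *)

Section Morita.
Variables (R S : rngType) (luR : local_units R) (luS : local_units S).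
Variable T : functor (fgProj R) (fgProj S).
Hypotheses (addT : additive_functor T) (wT : weak_equivalence T).

(* [M] is a quotient of [pres], [M'] is a quotient of [T pres], and [T] matches
   the two systems of relations. *)
Record presentation (M : fgMod R) (M' : fgMod S) := Presentation {
  pres : fgProj R;
  pres_l : modhom (fgProj_module pres) (fgMod_module M);
  pres_r : modhom (fgProj_module (T pres)) (fgMod_module M');
  pres_l_surj : surjective_fun pres_l;
  pres_r_surj : surjective_fun pres_r;
  pres_kills : forall Q (h : mor Q pres), kills pres_l h <-> kills pres_r (fmap T h)
}.

Arguments pres_kills {M M'} p {Q} h.

(** A lift [phi] is determined only up to maps into the kernel of [pres_l b], so the correspondence
    of morphisms is set up as a relation. *)
Definition lifted (M : fgMod R) (M' : fgMod S) (N : fgMod R) (N' : fgMod S)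
    (a : presentation M M') (b : presentation N N') (f : mor M N) (f' : mor M' N') : Prop :=
  exists phi : mor (pres a) (pres b),
    (forall x, pres_l b (fgProj_hom phi x) = fgMod_hom f (pres_l a x)) /\
    (forall x, pres_r b (fgProj_hom (fmap T phi) x) = fgMod_hom f' (pres_r a x)).

(** A cover of [z] inside the kernel starts at some [Q'] isomorphic to an object [T Q]; fullness
    then writes it as [T h]. *)
Lemma kernel_cover (P : fgProj R) (N : rngModType S)
    (q : modhom (fgProj_module (T P)) N) z : q z = 0 ->
  exists Q (h : mor Q P) w, kills q (fmap T h) /\ fgProj_hom (fmap T h) w = z.
Proof.
have [_ uT sT] := wT; move=> qz.
have [Q' [h' [hz kerh]]] := fgProj_cover luS [:: z] (@fgProj_unitary _ (T P)).
have [w wz] := hz z (mem_head _ _).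
have [Q [i [j [_ ij]]]] := sT Q'.
have [h hE] := uT _ _ (mcomp (h' : mor Q' (T P)) i).
exists Q, h, (fgProj_hom j w); rewrite hE; split=> [x|].
  by apply: (kerh _ (submodule_ker q)) => y; rewrite inE => /eqP ->.
by rewrite fgProj_homM (fgProj_homK ij).
Qed.

Lemma presentation_l (M : fgMod R) : exists M', inhabited (presentation M M').
Proof.
have [fT uT _] := wT; have [s gs] := proj2_sig M.
have [P [p [ps _]]] := fgProj_cover luR s (proj2_sig (sval M)).
have sp : surjective_fun p by apply: (gs _ (submodule_img p)).
(* The sieve on [T P] generated by the images of the relations of [M]; [M'] is the corresponding
   quotient. *)
pose I Q' (h' : mor Q' (T P)) :=
  exists Q (h : mor Q P) (a : mor Q' (T Q)), kills p h /\ mcomp (fmap T h) a = h'.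
have [||Q1 Q2 _ _ [K1 [k1 [a1 [p1 <-]]]] [K2 [k2 [a2 [p2 <-]]]]|] :=
    @sieve_quotient S luS (T P) I.
- exists (T P), (mcomp (fmap T 0) (idm _)), P, 0, (idm _); split=> // x.
  exact: modhom0.
- move=> Q Q' _ b [K [k [a [pk <-]]]].
  by exists K, k, (mcomp a b); rewrite compA.
- have [Q [h [b1 [b2 [ph <- <-]]]]] := kernel_directed luR p1 p2.
  exists (T Q), (fmap T h), (mcomp (fmap T b1) a1), (mcomp (fmap T b2) a2).
  by rewrite !fmapM !compA; split=> //; exists Q, h, (idm _); rewrite compm1.
move=> M' [q [sq kq]]; exists M'; constructor; exists P p q => // Q h.
rewrite kq; split=> [ph|[K [k [a [pk ka]]]]].
  by exists Q, h, (idm _); rewrite compm1.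
(* No new relations arise: [T h = T k a] with [a = T b] forces [h = k b], which [p] kills. *)
have [b bE] := uT _ _ a; move: ka; rewrite -bE -fmapM => /fT <- x.
exact: pk.
Qed.

Lemma presentation_r (M' : fgMod S) : exists M, inhabited (presentation M M').
Proof.
have [fT uT sT] := wT; have [s gs] := proj2_sig M'.
have [P' [p' [ps _]]] := fgProj_cover luS s (proj2_sig (sval M')).
have sp' : surjective_fun p' by apply: (gs _ (submodule_img p')).
have [P [i [j [_ ij]]]] := sT P'.
pose q := modhom_comp p' (fgProj_hom i).
have sq : surjective_fun q.
  move=> y; have [x <-] := sp' y; exists (fgProj_hom j x).
  by rewrite /= (fgProj_homK ij).
have [||Q1 Q2 h1 h2 k1 k2|] :=
    @sieve_quotient R luR P (fun Q (h : mor Q P) => kills q (fmap T h)).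
- by exists P, 0; rewrite fmap0 // => x; exact: modhom0.
- by move=> Q Q' h a kh x; rewrite fmapM; exact: kh.
(* Directedness holds over [S]; replacing [Q'] by an isomorphic [T Q] brings it back to [R]. *)
- have [Q' [h' [a1 [a2 [kh' ha1 ha2]]]]] := kernel_directed luS k1 k2.
  have [Q [u [v [_ uv]]]] := sT Q'.
  have [h hE] := uT _ _ (mcomp h' u).
  have [b1 b1E] := uT _ _ (mcomp v a1); have [b2 b2E] := uT _ _ (mcomp v a2).
  exists Q, h, b1, b2; rewrite hE; split.
  + by move=> x; exact: kh'.
  + by apply: fT; rewrite fmapM hE b1E -compA (compA u) uv comp1m.
  + by apply: fT; rewrite fmapM hE b2E -compA (compA u) uv comp1m.
by move=> M [p [sp kp]]; exists M; constructor; exists P p q.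
Qed.

Section Lifting.
Variables (M N : fgMod R) (M' N' : fgMod S).
Variables (a : presentation M M') (b : presentation N N').

(** Projectivity lifts [f] to [phi]. Then [T phi] descends to [M']: by [kernel_cover] the kernel of
    [pres_r a] is covered by maps [T h], and [pres_kills] passes their relations through [phi]. *)
Lemma lifted_l f : exists f', lifted a b f f'.
Proof.
have [|phi phiE] := @fgProj_lift _ luR _ _ _
    (modhom_comp (fgMod_hom f) (pres_l a)) (pres_l b) (proj2_sig (sval N)).
  by move=> x; exact: pres_l_surj.
have [|f' f'E] := modhom_descend
    (f := modhom_comp (pres_r b) (fgProj_hom (fmap T phi))) (@pres_r_surj _ _ a).
  move=> z /kernel_cover[Q [h [w [/pres_kills kh <-]]]] /=.
  have kb : kills (pres_l b) (mcomp phi h).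
    by move=> x; rewrite fgProj_homM phiE /= kh modhom0.
  by rewrite -fgProj_homM -fmapM; exact: ((pres_kills b _).1 kb w).
by exists f', phi; split=> // x; rewrite -[LHS]f'E.
Qed.

Lemma lifted_r f' : exists f, lifted a b f f'.
Proof.
have [|phi' phiE] := @fgProj_lift _ luS _ _ _
    (modhom_comp (fgMod_hom f') (pres_r a)) (pres_r b) (proj2_sig (sval N')).
  by move=> x; exact: pres_r_surj.
have [_ uT _] := wT; have [phi phiT] := uT _ _ phi'; subst phi'.
have [|f fE] := modhom_descend
    (f := modhom_comp (pres_l b) (fgProj_hom phi)) (@pres_l_surj _ _ a).
  move=> x px0; have [Q [h [hx kerh]]] :=
    fgProj_cover luR [:: x] (@fgProj_unitary _ (pres a)).
  have [w <-] := hx x (mem_head _ _).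
  have /pres_kills kh : kills (pres_l a) (h : mor Q (pres a)).
    by apply: (kerh _ (submodule_ker (pres_l a))) => y; rewrite inE => /eqP ->.
  have kb : kills (pres_r b) (fmap T (mcomp phi (h : mor Q (pres a)))).
    by move=> y; rewrite fmapM fgProj_homM phiE /= kh modhom0.
  exact: ((pres_kills b _).2 kb w).
by exists f, phi; split=> // x; rewrite -[LHS]fE.
Qed.

(** A zero [f] means that [pres_l b] kills [phi], so [pres_r b] kills [T phi] by [pres_kills]. *)
Lemma lifted0_l f' : lifted a b 0 f' -> f' = 0.
Proof.
move=> [phi [phiE phiE']]; apply: modhom_eq => y.
have [x <-] := pres_r_surj a y; rewrite -[LHS]phiE'.
exact: ((pres_kills b phi).1 phiE).
Qed.

Lemma lifted0_r f : lifted a b f 0 -> f = 0.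
Proof.
move=> [phi [phiE phiE']]; apply: modhom_eq => y.
have [x <-] := pres_l_surj a y; rewrite -[LHS]phiE.
exact: ((pres_kills b phi).2 phiE').
Qed.

Lemma liftedB f g f' g' :
  lifted a b f f' -> lifted a b g g' -> lifted a b (f - g) (f' - g').
Proof.
move=> [phi [phiE phiE']] [psi [psiE psiE']]; exists (phi - psi).
split=> x; first by rewrite fgProj_homB modhomB phiE psiE.
by rewrite (fmapB _ _ addT) fgProj_homB modhomB phiE' psiE'.
Qed.

End Lifting.

Lemma lifted1 M M' (a : presentation M M') : lifted a a (idm M) (idm M').
Proof. by exists (idm _); rewrite fmap1. Qed.

Lemma liftedM L L' M M' N N' (a : presentation L L') (b : presentation M M')
    (c : presentation N N') g g' f f' :
  lifted b c g g' -> lifted a b f f' -> lifted a c (mcomp g f) (mcomp g' f').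
Proof.
move=> [phi [phiE phiE']] [psi [psiE psiE']]; exists (mcomp phi psi).
by split=> x; rewrite ?fmapM fgProj_homM ?phiE ?phiE' ?psiE ?psiE'.
Qed.

Lemma fgMod_equivalence :
  exists F : functor (fgMod R) (fgMod S),
    additive_functor F /\ weak_equivalence F.
Proof.
apply: (@correspondence_equivalence _ _ presentation lifted).
- exact: presentation_l.
- exact: presentation_r.
- by move=> *; exact: lifted_l.
- by move=> *; exact: lifted_r.
- move=> M M' N N' a b f'; exact: lifted0_l.
- move=> M M' N N' a b f; exact: lifted0_r.
- move=> M M' N N' a b f g f' g'; exact: liftedB.
- exact: lifted1.
- move=> L L' M M' N N' a b c g g' f f'; exact: liftedM.
Qed.

End Morita.

(** * Right modules and the equivalence of the two conditions *)

Lemma local_units_conv (R : rngType) : local_units R -> local_units R^c.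
Proof.
move=> luR s; have [e [ee es]] := luR s; exists e; split=> // x xs.
have [r ->] := es x xs; exists r.
by rewrite -[LHS]rngmulA.
Qed.

Theorem corollaryA (R S : rngType)
    (localR : local_units R) (localS : local_units S) :
  duality (fgMod R) (fgMod S^c) <->
  left_Morita R /\ duality (fgInj R) (fgProj S^c).
Proof.
have luS := local_units_conv localS.
split=> [dual|[[R' [/local_units_conv luR' dual]] /dualityP[F [addF wF]]]].
  split; first by exists S.
  exact: duality_fgInj_fgProj.
have /dualityP[G [addG wG]] := duality_fgInj_fgProj localR luR' dual.
(* Composing [F] with the inverse [H] of [G] cancels the two contravariances and leaves an additive
   equivalence from [fgProj R'^c] to [fgProj S^c]. *)
have [H [addH wH]] := weak_equivalence_inverse addG wG.
have [|K [addK wK]] := fgMod_equivalence luR' luS _ (weak_equivalence_comp wF wH).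
  by move=> P Q f g /=; rewrite addH addF.
move/dualityP: dual => [D [addD wD]]; apply/dualityP.
exists (functor_comp K D); split; last exact: weak_equivalence_comp.
by move=> M N f g /=; rewrite addD addK.
Qed.
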